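(* Let $G=(V,E)$ be an interval graph with $n$ vertices, given together with its interval representation, with weight function $w:V\to\mathbb{R}^+$, budget function $b:V\to\mathbb{Z}^+$ and a positive integer $B$. Then an optimal solution of MWBIS on $(G,w,b,B)$ can be computed in $O(n(n+B))$ time.
   Context: An interval graph has a vertex for each interval in a given family, with two vertices adjacent iff their intervals intersect. For $S\subseteq V$, weight is $\sum_{v\in S}w(v)$ and budget is $\sum_{v\in S}b(v)$; a $B$-budgeted independent set is an independent set with budget at most $B$. MWBIS: find a $B$-budgeted independent set of maximum weight among all $B$-budgeted independent sets. *)

(* Defs.v *)
From mathcomp Require Import all_boot all_order all_algebra.
From mathcomp Require Import reals.

Set Implicit Arguments.
Unset Strict Implicit.
Unset Printing Implicit Defensive.

Import Order.TTheory GRing.Theory Num.Theory.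

Section Budgeted_independent_sets.
Variables (R : realType) (n : nat).

Definition intervals_intersect (l r : 'I_n -> R) (u v : 'I_n) : Prop :=
  exists x : R, x \in `[l u, r u]%R /\ x \in `[l v, r v]%R.

(* The vertex v is represented by the nonempty closed interval [l v, r v];    *)
(* the edge relation E is then automatically symmetric and irreflexive.       *)
Definition interval_representation (E : rel 'I_n) (l r : 'I_n -> R) : Prop :=
  (forall v, l v <= r v)%R /\
  (forall u v, E u v <-> u <> v /\ intervals_intersect l r u v).

Variables (E : rel 'I_n) (w : 'I_n -> R) (b : 'I_n -> nat) (B : nat).

Definition weight (S : {set 'I_n}) : R := (\sum_(v in S) w v)%R.

Definition budget (S : {set 'I_n}) : nat := \sum_(v in S) b v.

Definition independent (S : {set 'I_n}) : Prop :=
  forall u v, u \in S -> v \in S -> ~~ E u v.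

Definition budgeted_independent (S : {set 'I_n}) : Prop :=
  independent S /\ budget S <= B.

Definition MWBIS_optimal (S : {set 'I_n}) : Prop :=
  budgeted_independent S /\
  forall S' : {set 'I_n}, budgeted_independent S' -> (weight S' <= weight S)%R.

End Budgeted_independent_sets.

(* The model of computation is a two-sorted (real) RAM, presented as a        *)
(* structured imperative language. There are variables and random-access      *)
(* arrays of natural numbers and of real numbers; the names of variables and  *)
(* arrays are fixed in the program text, only array indices are computed.     *)
(* Reals can only be copied, added, subtracted and compared: there is no      *)
(* rounding, no conversion to an integer, and no real literal but 0.          *)
Inductive iexp : Type :=
| ILit of nat
| IVar of nat
| IGet of nat & iexp
| IAdd of iexp & iexp
| ISub of iexp & iexp.

Inductive rexp : Type :=
| RZero
| RVar of nat
| RGet of nat & iexp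
| RAdd of rexp & rexp
| RSub of rexp & rexp.

Inductive bexp : Type :=
| BILe of iexp & iexp
| BRLe of rexp & rexp
| BNot of bexp
| BAnd of bexp & bexp.

Inductive com : Type :=
| Skip
| ISet of nat & iexp
| RSet of nat & rexp
| IPut of nat & iexp & iexp
| RPut of nat & iexp & rexp
| Seq of com & com
| If of bexp & com & com
| While of bexp & com.

(* Evaluating an expression costs one time unit per node.                     *)
Fixpoint icost (e : iexp) : nat :=
  match e with
  | ILit _ | IVar _ => 1
  | IGet _ e1 => (icost e1).+1
  | IAdd e1 e2 | ISub e1 e2 => (icost e1 + icost e2).+1
  end.

Fixpoint rcost (e : rexp) : nat :=
  match e with
  | RZero | RVar _ => 1
  | RGet _ e1 => (icost e1).+1
  | RAdd e1 e2 | RSub e1 e2 => (rcost e1 + rcost e2).+1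
  end.

Fixpoint bcost (c : bexp) : nat :=
  match c with
  | BILe e1 e2 => (icost e1 + icost e2).+1
  | BRLe e1 e2 => (rcost e1 + rcost e2).+1
  | BNot c1 => (bcost c1).+1
  | BAnd c1 c2 => (bcost c1 + bcost c2).+1
  end.

Definition update (T : Type) (f : nat -> T) (i : nat) (x : T) : nat -> T :=
  fun j => if j == i then x else f j.

Section Semantics.
Variable R : realType.

Record state : Type := State {
  ivar : nat -> nat;
  rvar : nat -> R;
  iarr : nat -> nat -> nat;
  rarr : nat -> nat -> R
}.

Definition set_ivar (s : state) (x k : nat) : state :=
  State (update (ivar s) x k) (rvar s) (iarr s) (rarr s).

Definition set_rvar (s : state) (x : nat) (a : R) : state :=
  State (ivar s) (update (rvar s) x a) (iarr s) (rarr s).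

Definition set_iarr (s : state) (m i k : nat) : state :=
  State (ivar s) (rvar s) (update (iarr s) m (update (iarr s m) i k)) (rarr s).

Definition set_rarr (s : state) (m i : nat) (a : R) : state :=
  State (ivar s) (rvar s) (iarr s) (update (rarr s) m (update (rarr s m) i a)).

(* ISub is truncated subtraction.                                             *)
Fixpoint ieval (s : state) (e : iexp) : nat :=
  match e with
  | ILit k => k
  | IVar x => ivar s x
  | IGet m e1 => iarr s m (ieval s e1)
  | IAdd e1 e2 => ieval s e1 + ieval s e2
  | ISub e1 e2 => ieval s e1 - ieval s e2
  end.

Fixpoint reval (s : state) (e : rexp) : R :=
  match e with
  | RZero => 0%R
  | RVar x => rvar s x
  | RGet m e1 => rarr s m (ieval s e1)
  | RAdd e1 e2 => (reval s e1 + reval s e2)%R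
  | RSub e1 e2 => (reval s e1 - reval s e2)%R
  end.

Fixpoint beval (s : state) (c : bexp) : bool :=
  match c with
  | BILe e1 e2 => ieval s e1 <= ieval s e2
  | BRLe e1 e2 => (reval s e1 <= reval s e2)%R
  | BNot c1 => ~~ beval s c1
  | BAnd c1 c2 => beval s c1 && beval s c2
  end.

(* exec p s t s' : started in s, the program p halts in s' after t time units. *)
Inductive exec : com -> state -> nat -> state -> Prop :=
| exec_Skip s : exec Skip s 1 s
| exec_ISet s x e : exec (ISet x e) s (icost e).+1 (set_ivar s x (ieval s e))
| exec_RSet s x e : exec (RSet x e) s (rcost e).+1 (set_rvar s x (reval s e))
| exec_IPut s m i e :
    exec (IPut m i e) s (icost i + icost e).+1
         (set_iarr s m (ieval s i) (ieval s e))
| exec_RPut s m i e :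
    exec (RPut m i e) s (icost i + rcost e).+1
         (set_rarr s m (ieval s i) (reval s e))
| exec_Seq p1 p2 s1 s2 s3 t1 t2 :
    exec p1 s1 t1 s2 -> exec p2 s2 t2 s3 -> exec (Seq p1 p2) s1 (t1 + t2) s3
| exec_If_true c p1 p2 s s' t :
    beval s c -> exec p1 s t s' -> exec (If c p1 p2) s (bcost c + t).+1 s'
| exec_If_false c p1 p2 s s' t :
    ~~ beval s c -> exec p2 s t s' -> exec (If c p1 p2) s (bcost c + t).+1 s'
| exec_While_true c p s1 s2 s3 t1 t2 :
    beval s1 c -> exec p s1 t1 s2 -> exec (While c p) s2 t2 s3 ->
    exec (While c p) s1 (bcost c + t1 + t2).+1 s3
| exec_While_false c p s :
    ~~ beval s c -> exec (While c p) s (bcost c).+1 s.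

Lemma exec_deterministic p s t1 s1 t2 s2 :
  exec p s t1 s1 -> exec p s t2 s2 -> t1 = t2 /\ s1 = s2.
Proof.
move=> H; elim: H t2 s2 => {p s t1 s1};
  intros; match goal with H : exec _ _ _ ?s |- _ /\ _ = ?s => inversion H end;
  subst; try by [].
all: repeat match goal with
  | h : is_true (~~ ?c), h' : is_true ?c |- _ => by rewrite h' in h
  | IH : forall t s, exec ?p ?s0 t s -> _, h : exec ?p ?s0 _ _ |- _ =>
      case: (IH _ _ h) => ? ?; subst; clear h
  end; by [].
Qed.

(* All memory not mentioned here, including array cells of index >= n, has    *)
(* arbitrary initial contents.                                                *)
Definition MWBIS_input (n : nat) (l r w : 'I_n -> R) (b : 'I_n -> nat)
    (B : nat) (s : state) : Prop :=
  [/\ ivar s 0 = n,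
      ivar s 1 = B
    & forall v : 'I_n,
        [/\ rarr s 0 v = l v, rarr s 1 v = r v, rarr s 2 v = w v
          & iarr s 0 v = b v]].

Definition MWBIS_output (n : nat) (s : state) : {set 'I_n} :=
  [set v : 'I_n | iarr s 1 v == 1].

End Semantics.

(* Main.v *)
Require Import Defs.
From mathcomp Require Import all_boot all_order all_algebra.
From mathcomp Require Import reals.
From mathcomp Require Import zify.

(* Order the vertices by right endpoint, ties being broken by index.  The     *)
(* neighbours of v among its predecessors are those u with l v <= r u, so the *)
(* non-neighbours of v among its predecessors form an initial segment of the  *)
(* order, of length #{u | r u < l v}.  Hence an optimal set inside the first  *)
(* k + 1 vertices with budget c either is optimal inside the first k          *)
(* vertices, or is {v} together with an optimal set inside that initial       *)
(* segment with budget c - b v.  Ranks and segment lengths are obtained by    *)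
(* counting in O(n^2) time, the (n + 1) x (B + 1) table of optimal weights is *)
(* filled in constant time per entry, and a solution is traced back in O(n)   *)
(* steps.                                                                     *)

Set Implicit Arguments.
Unset Strict Implicit.
Unset Printing Implicit Defensive.

Import Order.TTheory GRing.Theory Num.Theory.

(** * Timed total correctness *)

Section Timed_correctness.
Variable R : realType.
Implicit Types (s : state R) (p : com) (Q : state R -> Prop).

(** In the order by right endpoint, an earlier [u] is adjacent to [v] exactly when [r u] lies in the
    interval of [v] ([edge_before]). The vertices ending before [l v] thus fill a whole initial
    segment ([rank_lt_num_before]), and adding [v] to, or deleting it from, a set trades [b v] of
    budget for [w v] of weight ([feasible_add], [feasible_in]). This is the recurrence behind the
    table ([row_step]). Time and result are proved together through [runs]: loop-free code is
    evaluated symbolically ([runs_loop_free]), counted loops multiply a uniform bound ([runs_for]),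
    and the traceback follows the recurrence by strong induction ([trace_correct]). *)

Definition runs p s (t : nat) Q : Prop :=
  exists t' s', [/\ exec p s t' s', t' <= t & Q s'].

Lemma runs_weaken p s t t' Q Q' :
  runs p s t Q -> t <= t' -> (forall s', Q s' -> Q' s') -> runs p s t' Q'.
Proof.
move=> [t1 [s1 [h1 le1 q1]]] le2 QQ'; exists t1, s1; split=> //.
- exact: leq_trans le2.
- exact: QQ'.
Qed.

Lemma runs_Seq p1 p2 s t1 t2 Q1 Q2 :
  runs p1 s t1 Q1 -> (forall s', Q1 s' -> runs p2 s' t2 Q2) ->
  runs (Seq p1 p2) s (t1 + t2) Q2.
Proof.
move=> [u1 [s1 [h1 le1 q1]]] /(_ _ q1) [u2 [s2 [h2 le2 q2]]].
exists (u1 + u2), s2; split=> //; first exact: exec_Seq h1 h2.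
exact: leq_add.
Qed.

Lemma runs_While_true c p s t1 t2 Q1 Q2 :
  beval s c -> runs p s t1 Q1 ->
  (forall s', Q1 s' -> runs (While c p) s' t2 Q2) ->
  runs (While c p) s (bcost c + t1 + t2).+1 Q2.
Proof.
move=> hc [u1 [s1 [h1 le1 q1]]] /(_ _ q1) [u2 [s2 [h2 le2 q2]]].
exists (bcost c + u1 + u2).+1, s2; split=> //.
- exact: exec_While_true hc h1 h2.
- by rewrite ltnS leq_add // leq_add2l.
Qed.

Lemma runs_While_false c p s Q :
  ~~ beval s c -> Q s -> runs (While c p) s (bcost c).+1 Q.
Proof.
by move=> hc q; exists (bcost c).+1, s; split=> //; apply: exec_While_false.
Qed.

Lemma runs_for c p (N t : nat) (I : nat -> state R -> Prop) s :
  (forall k s', I k s' -> beval s' c = (k < N)) ->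
  (forall k s', k < N -> I k s' -> runs p s' t (I k.+1)) ->
  I 0 s ->
  runs (While c p) s (N * (bcost c + t).+1 + (bcost c).+1) (I N).
Proof.
move=> hc hp I0.
suff H m k s' : k + m = N -> I k s' ->
    runs (While c p) s' (m * (bcost c + t).+1 + (bcost c).+1) (I N).
  exact: (H N 0 s).
elim: m k s' => [|m IHm] k s' kN Ik.
  have kE : k = N by rewrite -kN addn0.
  by apply: runs_While_false; [rewrite (hc k) // kE ltnn | rewrite -kE].
have kltN : k < N by lia.
have h2 s2 : I k.+1 s2 ->
    runs (While c p) s2 (m * (bcost c + t).+1 + (bcost c).+1) (I N).
  by apply: IHm; lia.
have hck : beval s' c by rewrite (hc k).
by apply: (runs_weaken (runs_While_true hck (hp k s' kltN Ik) h2)) => //; lia.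
Qed.

Fixpoint loop_free p : bool :=
  match p with
  | Seq p1 p2 | If _ p1 p2 => loop_free p1 && loop_free p2
  | While _ _ => false
  | _ => true
  end.

(** An [If] is charged for both branches: the sum is an upper bound without a maximum, and only
    constants are lost. *)
Fixpoint cost_bound p : nat :=
  match p with
  | Skip => 1
  | ISet _ e => (icost e).+1
  | RSet _ e => (rcost e).+1
  | IPut _ i e => (icost i + icost e).+1
  | RPut _ i e => (icost i + rcost e).+1
  | Seq p1 p2 => cost_bound p1 + cost_bound p2
  | If c p1 p2 => (bcost c + (cost_bound p1 + cost_bound p2)).+1
  | While _ _ => 0
  end.

(* The clause for [While] is a junk value: [denote] is meant for loop-free    *)
(* programs only.                                                             *)
Fixpoint denote p s : state R :=
  match p with
  | Skip | While _ _ => s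
  | ISet x e => set_ivar s x (ieval s e)
  | RSet x e => set_rvar s x (reval s e)
  | IPut m i e => set_iarr s m (ieval s i) (ieval s e)
  | RPut m i e => set_rarr s m (ieval s i) (reval s e)
  | Seq p1 p2 => denote p2 (denote p1 s)
  | If c p1 p2 => if beval s c then denote p1 s else denote p2 s
  end.

Lemma runs_loop_free p s Q :
  loop_free p -> Q (denote p s) -> runs p s (cost_bound p) Q.
Proof.
move=> lfp q; suff [t [h le]] : exists t, exec p s t (denote p s) /\
    t <= cost_bound p by exists t, (denote p s).
elim: p s lfp {Q q} => //=; 
  try by move=> *; eexists; split; [constructor|].
- move=> p1 IH1 p2 IH2 s /andP[/(IH1 s)[t1 [h1 le1]]].
  move=> /(IH2 (denote p1 s))[t2 [h2 le2]]; exists (t1 + t2).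
  by split; [apply: exec_Seq h1 h2 | apply: leq_add].
- move=> c p1 IH1 p2 IH2 s /andP[/(IH1 s)[t1 [h1 le1]] /(IH2 s)[t2 [h2 le2]]].
  case: ifPn => hc.
  + by exists (bcost c + t1).+1; split; [apply: exec_If_true | lia].
  + by exists (bcost c + t2).+1; split; [apply: exec_If_false | lia].
Qed.

End Timed_correctness.

(** * Optimal sets inside initial segments *)

Section Initial_segments.
Variables (R : realType) (n : nat) (E : rel 'I_n) (l r w : 'I_n -> R).
Variable b : 'I_n -> nat.
Hypothesis rep : interval_representation E l r.
Implicit Types (u v : 'I_n) (S : {set 'I_n}).

(** Strict lexicographic order, written with [<=] and negation only so that it is literally the
    value of the test [bprec]. *)
Definition prec u v : bool :=
  (r u <= r v)%R && ~~ ((r v <= r u)%R && (v <= u)).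

Definition before u v : bool := ~~ (l v <= r u)%R.

Definition rank v : nat := \sum_u prec u v.

Definition num_before v : nat := \sum_u before u v.

Lemma prec_irr : irreflexive prec.
Proof. by move=> v; rewrite /prec lexx leqnn andbF. Qed.

Lemma prec_trans : transitive prec.
Proof.
rewrite /prec => v u x /andP[uv nvu] /andP[vx nxv].
rewrite (le_trans uv vx) /=; apply/negP => /andP[xu xleu].
move: nvu nxv; rewrite (le_trans vx xu) (le_trans xu uv) /=; lia.
Qed.

Lemma prec_total u v : u != v -> prec u v || prec v u.
Proof.
rewrite /prec => /negPf uv; have {}uv : u <> v :> nat.
  by move/val_inj/eqP; rewrite uv.
case: (ltgtP (r u) (r v)) => _ //=; lia.
Qed.

Lemma sum_bool_le (P Q : pred 'I_n) :
  subpred P Q -> \sum_u P u <= \sum_u Q u.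
Proof. by move=> PQ; apply: leq_sum => u _; case: (P u) (PQ u) => // ->. Qed.

Lemma sum_bool_lt (P Q : pred 'I_n) v :
  subpred P Q -> ~~ P v -> Q v -> \sum_u P u < \sum_u Q u.
Proof.
move=> PQ Pv Qv; rewrite (bigD1 v) //= [X in _ < X](bigD1 v) //= (negPf Pv) Qv.
rewrite add0n add1n ltnS; apply: leq_sum => u _.
by case: (P u) (PQ u) => // ->.
Qed.

Lemma prec_rank u v : prec u v -> rank u < rank v.
Proof.
move=> uv; apply: (@sum_bool_lt _ _ u) => //; last by rewrite prec_irr.
by move=> x xu; apply: prec_trans xu uv.
Qed.

Lemma rank_inj : injective rank.
Proof.
move=> u v uv; apply/eqP; apply: contraT => /prec_total /orP[] /prec_rank;
  by rewrite uv ltnn.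
Qed.

Lemma rank_prec u v : rank u < rank v -> prec u v.
Proof.
move=> uv; have /prec_total/orP[//|/prec_rank] : u != v.
  by apply: contraTneq uv => ->; rewrite ltnn.
by rewrite ltnNge ltnW.
Qed.

Lemma rank_lt v : rank v < n.
Proof.
have := @sum_bool_lt (prec^~ v) predT v; rewrite prec_irr.
by rewrite sum1_card card_ord; apply.
Qed.

(** An injective self-map of a finite set is onto. *)
Lemma rank_surj k : k < n -> exists v, rank v = k.
Proof.
move=> kn; pose f v := Ordinal (rank_lt v).
have f_inj : injective f by move=> u v [] /rank_inj.
exists (invF f_inj (Ordinal kn)).
by have /(congr1 val) := f_invF f_inj (Ordinal kn).
Qed.

Lemma num_before_rank v : num_before v <= rank v.
Proof.
apply: sum_bool_le => u; rewrite /before /prec -ltNge => uv.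
have lev := rep.1 v; have ur := lt_le_trans uv lev.
by rewrite (ltW ur) /= leNgt ur.
Qed.

(** If [u] ends before [l v], so do all its predecessors, and [u] itself makes the count strictly
    larger; otherwise every vertex ending before [l v] precedes [u]. *)
Lemma rank_lt_num_before u v : (rank u < num_before v) = before u v.
Proof.
apply/idP/idP; last first.
  rewrite /before -ltNge => uv.
  apply: (@sum_bool_lt _ _ u); first last.
  - by rewrite /before -ltNge.
  - by rewrite prec_irr.
  - move=> x /andP[xu _]; rewrite /before -ltNge.
    exact: le_lt_trans xu uv.
apply: contraTT; rewrite /before negbK -leqNgt => vu; apply: sum_bool_le => x.
rewrite /before /prec -ltNge => xv; have xu := lt_le_trans xv vu.
by rewrite (ltW xu) /= leNgt xu.
Qed.

Lemma edge_sym u v : E u v -> E v u.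
Proof.
case: rep => _ h /h [uv [x [xu xv]]]; apply/h.
by split; [apply: nesym | exists x].
Qed.

Lemma edge_irr v : ~~ E v v.
Proof. by apply/negP => /(rep.2 v v).1 []. Qed.

(** Since [r u <= r v], the intervals meet iff they share the point [r u]. *)
Lemma edge_before u v : rank u < rank v -> E u v = ~~ before u v.
Proof.
move=> uv; have [ruv _] := andP (rank_prec uv).
rewrite /before negbK; apply/idP/idP.
- move=> /(rep.2 u v).1 [_ [x []]]; rewrite !in_itv /=.
  by move=> /andP[_ xu] /andP[vx _]; apply: le_trans vx xu.
- move=> vu; apply/(rep.2 u v).2; split.
    by move=> uvE; rewrite uvE ltnn in uv.
  by exists (r u); rewrite !in_itv /= lexx vu ruv (rep.1 u).
Qed.

(** * The recurrence for optimal sets *)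

Definition feasible (k c : nat) S : Prop :=
  (forall u, u \in S -> rank u < k) /\ budgeted_independent E b c S.

Definition optimal (k c : nat) S : Prop :=
  feasible k c S /\ forall S', feasible k c S' -> (weight w S' <= weight w S)%R.

Lemma optimal_weight k c S S' :
  optimal k c S -> optimal k c S' -> weight w S = weight w S'.
Proof.
by move=> [f h] [f' h']; apply/eqP; rewrite eq_le h // h'.
Qed.

Lemma weight_set0 : weight w set0 = 0%R.
Proof. by rewrite /weight big_set0. Qed.

Lemma optimal_0 c : optimal 0 c set0.
Proof.
split.
  split; first by move=> u; rewrite in_set0.
  split; first by move=> u v; rewrite in_set0.
  by rewrite /budget big_set0.
move=> S [h _]; suff -> : S = set0 by [].
by apply/setP => u; rewrite in_set0; apply/negP => /h.
Qed.

Lemma feasibleS k c S : feasible k c S -> feasible k.+1 c S.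
Proof. by move=> [h ?]; split=> // u /h /ltnW. Qed.

Lemma feasible_notin v c S : feasible (rank v).+1 c S -> v \notin S ->
  feasible (rank v) c S.
Proof.
move=> [h ind] vS; split=> // u uS; have := h u uS.
rewrite ltnS leq_eqVlt => /orP[/eqP/rank_inj uv|//].
by rewrite -uv uS in vS.
Qed.

(** The other members precede [v] and are not adjacent to it, so they end before [l v]. *)
Lemma feasible_in v c S : feasible (rank v).+1 c S -> v \in S ->
  b v <= c /\ feasible (num_before v) (c - b v) (S :\ v).
Proof.
move=> [h [ind bud]] vS.
have budE : budget b S = b v + budget b (S :\ v).
  by rewrite /budget (big_setD1 v).
split; first by lia.
split; last first.
  split; last by lia.
  by move=> x y; rewrite !inE => /andP[_ xS] /andP[_ yS]; apply: ind.
move=> u; rewrite !inE => /andP[uv uS]; rewrite rank_lt_num_before.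
have ltuv : rank u < rank v.
  have := h u uS; rewrite ltnS leq_eqVlt => /orP[/eqP/rank_inj uvE|//].
  by rewrite uvE eqxx in uv.
by have := ind u v uS vS; rewrite edge_before // negbK.
Qed.

Lemma notin_before v c S : feasible (num_before v) c S -> v \notin S.
Proof.
by move=> [h _]; apply/negP => /h; rewrite ltnNge num_before_rank.
Qed.

Lemma feasible_add v c S : b v <= c -> feasible (num_before v) (c - b v) S ->
  feasible (rank v).+1 c (v |: S).
Proof.
move=> bv fS; have vS := notin_before fS; have [h [ind bud]] := fS.
have hE u : u \in S -> ~~ E u v.
  move=> /h; move=> lt_u; rewrite edge_before; last first.
    exact: leq_trans (num_before_rank v).
  by rewrite negbK -rank_lt_num_before.
split.
  move=> u; rewrite !inE => /orP[/eqP-> //|/h] lt_u.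
  exact/ltnW/(leq_trans lt_u)/num_before_rank.
split; last first.
  have -> : budget b (v |: S) = b v + budget b S by rewrite /budget big_setU1.
  by lia.
move=> x y; rewrite !inE => /orP[/eqP->|xS] /orP[/eqP->|yS].
- exact: edge_irr.
- by apply/negP => /edge_sym; apply/negP/hE.
- exact: hE.
- exact: ind.
Qed.

Lemma weight_add v S : v \notin S -> weight w (v |: S) = (weight w S + w v)%R.
Proof. by move=> vS; rewrite /weight big_setU1 //= addrC. Qed.

Lemma weight_rem v S : v \in S -> weight w S = (weight w (S :\ v) + w v)%R.
Proof. by move=> vS; rewrite /weight (big_setD1 v) //= addrC. Qed.

(** The hypothesis on [S1] is vacuous when [v] exceeds the budget, so this covers both reasons for
    leaving [v] out. *)
Lemma optimal_skip v c S0 : optimal (rank v) c S0 ->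
  (forall S1, b v <= c -> feasible (num_before v) (c - b v) S1 ->
     (weight w S1 + w v <= weight w S0)%R) ->
  optimal (rank v).+1 c S0.
Proof.
move=> [f0 h0] h1; split; first exact: feasibleS.
move=> S fS; have [vS|vS] := boolP (v \in S); last exact/h0/feasible_notin.
by rewrite (weight_rem vS); have [bv f1] := feasible_in fS vS; apply: h1.
Qed.

Lemma optimal_take v c S0 S1 : b v <= c -> optimal (rank v) c S0 ->
  optimal (num_before v) (c - b v) S1 ->
  (weight w S0 <= weight w S1 + w v)%R ->
  optimal (rank v).+1 c (v |: S1).
Proof.
move=> bv [f0 h0] [f1 h1] le01; split; first exact: feasible_add.
rewrite weight_add; last exact: notin_before f1.
move=> S fS; have [vS|vS] := boolP (v \in S); last first.
  by apply: le_trans le01; apply/h0/feasible_notin.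
by rewrite (weight_rem vS) lerD2r; have [_ f2] := feasible_in fS vS; apply: h1.
Qed.

Lemma optimal_trace_skip v c S0 S1 S : optimal (rank v) c S0 ->
  optimal (rank v).+1 c S1 -> (weight w S1 <= weight w S0)%R ->
  optimal (rank v) c S -> optimal (rank v).+1 c S.
Proof.
move=> o0 [f1 h1] le10 o; rewrite (optimal_weight o0 o) in le10.
split; first by apply: feasibleS; case: o.
by move=> S' /h1 h; apply: le_trans le10.
Qed.

(** A strict gain in weight forces [v] into [S1]. The sets behind the table entries are known only
    to exist, so the conclusion holds for whichever optimal [S] the rest of the traceback finds. *)
Lemma optimal_trace_take v c S0 S1 : optimal (rank v) c S0 ->
  optimal (rank v).+1 c S1 -> ~~ (weight w S1 <= weight w S0)%R ->
  b v <= c /\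
  forall S, optimal (num_before v) (c - b v) S ->
    optimal (rank v).+1 c (v |: S).
Proof.
move=> [_ h0] [f1 h1] nle10.
have vS1 : v \in S1.
  by apply: contraR nle10 => vS1; apply/h0/feasible_notin.
have [bv f] := feasible_in f1 vS1; split=> // S [fS hS].
split; first exact: feasible_add.
move=> S' /h1 h; apply: (le_trans h).
rewrite weight_add ?(notin_before fS) // (weight_rem vS1) lerD2r.
exact: hS.
Qed.

Lemma optimal_MWBIS B S : optimal n B S -> MWBIS_optimal E w b B S.
Proof.
move=> [[_ bi] h]; split=> // S' bi'; apply: h; split=> // u _.
exact: rank_lt.
Qed.

End Initial_segments.

(** * The program *)

(* There is no multiplication, so ranks and segment lengths are stored        *)
(* multiplied by the row length B + 1 of the table.                           *)
(*   integer variables  2, 3  loop counters (3 is also the remaining budget)  *)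
(*                      4     current vertex                                  *)
(*                      5     offset of the current row                       *)
(*                      6     B + 1                                           *)
(*                      7, 8  accumulators for rank and num_before            *)
(*   integer arrays     2     num_before v * (B + 1), at index v              *)
(*                      3     v, at index rank v * (B + 1)                    *)
(*   real array         3     optimal weight for (k, c), at k * (B + 1) + c   *)

Definition incr (x : nat) (e : iexp) : com := ISet x (IAdd (IVar x) e).

Definition bprec : bexp :=
  BAnd (BRLe (RGet 1 (IVar 3)) (RGet 1 (IVar 2)))
       (BNot (BAnd (BRLe (RGet 1 (IVar 2)) (RGet 1 (IVar 3)))
                   (BILe (IVar 2) (IVar 3)))).

Definition bbefore : bexp :=
  BNot (BRLe (RGet 0 (IVar 2)) (RGet 1 (IVar 3))).

Definition count_body : com :=
  Seq (If bprec (incr 7 (IVar 6)) Skip)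
  (Seq (If bbefore (incr 8 (IVar 6)) Skip)
       (incr 3 (ILit 1))).

Definition count_loop : com :=
  While (BILe (IAdd (IVar 3) (ILit 1)) (IVar 0)) count_body.

Definition sort_pre : com :=
  Seq (ISet 7 (ILit 0)) (Seq (ISet 8 (ILit 0)) (ISet 3 (ILit 0))).

Definition sort_post : com :=
  Seq (IPut 2 (IVar 2) (IVar 8))
  (Seq (IPut 3 (IVar 7) (IVar 2))
  (Seq (IPut 1 (IVar 2) (ILit 0)) (incr 2 (ILit 1)))).

Definition sort_loop : com :=
  While (BILe (IAdd (IVar 2) (ILit 1)) (IVar 0))
    (Seq sort_pre (Seq count_loop sort_post)).

Definition row0_loop : com :=
  While (BILe (IVar 3) (IVar 1))
    (Seq (RPut 3 (IVar 3) RZero) (incr 3 (ILit 1))).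

Definition skip_value : rexp := RGet 3 (IAdd (IVar 5) (IVar 3)).

Definition take_value : rexp :=
  RAdd (RGet 3 (IAdd (IGet 2 (IVar 4)) (ISub (IVar 3) (IGet 0 (IVar 4)))))
       (RGet 2 (IVar 4)).

Definition next_row_cell : iexp := IAdd (IAdd (IVar 5) (IVar 6)) (IVar 3).

Definition row_body : com :=
  Seq (If (BAnd (BILe (IGet 0 (IVar 4)) (IVar 3)) (BRLe skip_value take_value))
          (RPut 3 next_row_cell take_value)
          (RPut 3 next_row_cell skip_value))
      (incr 3 (ILit 1)).

Definition row_loop : com := While (BILe (IVar 3) (IVar 1)) row_body.

Definition table_pre : com := Seq (ISet 4 (IGet 3 (IVar 5))) (ISet 3 (ILit 0)).

Definition table_post : com := Seq (incr 5 (IVar 6)) (incr 2 (ILit 1)).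

Definition table_loop : com :=
  While (BILe (IAdd (IVar 2) (ILit 1)) (IVar 0))
    (Seq table_pre (Seq row_loop table_post)).

Definition trace_body : com :=
  Seq (ISet 4 (IGet 3 (ISub (IVar 5) (IVar 6))))
      (If (BRLe (RGet 3 (IAdd (IVar 5) (IVar 3)))
                (RGet 3 (IAdd (ISub (IVar 5) (IVar 6)) (IVar 3))))
          (ISet 5 (ISub (IVar 5) (IVar 6)))
          (Seq (IPut 1 (IVar 4) (ILit 1))
          (Seq (ISet 5 (IGet 2 (IVar 4)))
               (ISet 3 (ISub (IVar 3) (IGet 0 (IVar 4))))))).

Definition trace_loop : com := While (BILe (ILit 1) (IVar 5)) trace_body.

Definition init : com :=
  Seq (ISet 6 (IAdd (IVar 1) (ILit 1))) (ISet 2 (ILit 0)).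

Definition init_table : com := Seq (ISet 2 (ILit 0)) (ISet 5 (ILit 0)).

(* When n = 0 the time bound is constant, so row 0 must not be initialised.   *)
Definition mwbis : com :=
  If (BILe (ILit 1) (IVar 0))
     (Seq init
     (Seq sort_loop
     (Seq (ISet 3 (ILit 0))
     (Seq row0_loop
     (Seq init_table
     (Seq table_loop
     (Seq (ISet 3 (IVar 1)) trace_loop)))))))
     Skip.

Section Program_correctness.
Variables (R : realType) (n B : nat) (E : rel 'I_n) (l r w : 'I_n -> R).
Variable b : 'I_n -> nat.
Hypothesis rep : interval_representation E l r.
Implicit Types (s : state R) (u v : 'I_n).

Let rk := rank r.
Let nb := num_before l r.
Let opt := optimal E r w b.

Definition ready s : Prop := MWBIS_input l r w b B s /\ ivar s 6 = B.+1.

(** * Ranks and segment lengths by counting *)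

Lemma sum_below_ordS (F : 'I_n -> nat) j (jn : j < n) :
  \sum_(u < n | u < j.+1) F u = \sum_(u < n | u < j) F u + F (Ordinal jn).
Proof.
rewrite (bigD1 (Ordinal jn)) //= addnC; congr (_ + _); apply: eq_bigl => u.
by rewrite -(inj_eq val_inj) /=; lia.
Qed.

Lemma sum_below_ord0 (F : 'I_n -> nat) : \sum_(u < n | u < 0) F u = 0.
Proof. exact: big_pred0. Qed.

Lemma sum_below_ordn (F : 'I_n -> nat) :
  \sum_(u < n | u < n) F u = \sum_u F u.
Proof. by apply: eq_bigl => u; rewrite ltn_ord. Qed.

Definition count_inv s0 v j s : Prop :=
  [/\ ready s, iarr s = iarr s0, ivar s 2 = v, ivar s 3 = j
    & ivar s 7 = (\sum_(u < n | u < j) prec r u v) * B.+1 /\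
      ivar s 8 = (\sum_(u < n | u < j) before l r u v) * B.+1].

Lemma count_correct s0 v s : count_inv s0 v 0 s ->
  runs count_loop s (n * 50 + 6) (count_inv s0 v n).
Proof.
(* The guard costs 5 and the body at most 44, hence 50 per turn and 6 for the exit test. *)
move=> I0; apply: (runs_for (t := 44)) I0.
  by move=> k s' [[[nE _ _] _] _ _ kE _]; rewrite /= nE kE addn1.
move=> k s' kn [[[nE BE arr] WE] iE vE kE [E7 E8]].
apply: (runs_weaken (runs_loop_free (Q := count_inv s0 v k.+1) _ _)) => //.
have [_ ru _ _] := arr (Ordinal kn); rewrite [nat_of_ord _]/= in ru.
have [lv rv _ _] := arr v.
have h1 : beval s' bprec = prec r (Ordinal kn) v by rewrite /= vE kE ru rv.
have h2 : beval s' bbefore = before l r (Ordinal kn) v.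
  by rewrite /= vE kE ru lv.
have h2' : beval (denote (incr 7 (IVar 6)) s') bbefore = beval s' bbefore by [].
rewrite /count_inv !(sum_below_ordS _ kn) /count_body; cbn [denote]; rewrite h1.
case: (prec _ _ _); cbn [denote]; rewrite ?h2' h2; case: (before _ _ _ _);
  split; rewrite /= /update /= ?kE ?addn1 ?E7 ?E8 ?WE ?addn0 //;
  by rewrite ![_.+1 * _]mulSn ![B.+1 + _]addnC.
Qed.

Definition sorted_below k s : Prop :=
  forall v, v < k -> [/\ iarr s 2 v = nb v * B.+1,
                         iarr s 3 (rk v * B.+1) = v & iarr s 1 v = 0].

Definition sort_inv k s : Prop :=
  [/\ ready s, ivar s 2 = k & sorted_below k s].

Lemma sort_correct s : sort_inv 0 s ->
  runs sort_loop s (n * (n * 50 + 50) + 6) (sort_inv n).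
Proof.
move=> I0; apply: (runs_weaken (t := n * (5 + (6 + (n * 50 + 6 + 13))).+1 + 6)
  _ _ (fun _ => id)); last by lia.
apply: (runs_for (t := 6 + (n * 50 + 6 + 13))) I0.
  by move=> k s' [[[nE _ _] _] kE _]; rewrite /= nE kE addn1.
move=> k s' kn [[inp WE] kE srt]; pose v := Ordinal kn.
apply: (runs_Seq (Q1 := count_inv s' v 0)).
  apply: (runs_loop_free (p := sort_pre)) => //.
  by rewrite /count_inv !sum_below_ord0.
move=> s1 /count_correct h1; apply: runs_Seq h1 _.
move=> s2 [[inp2 WE2] iE2 vE2 _]; rewrite !sum_below_ordn => -[E7 E8].
apply: (runs_loop_free (p := sort_post)) => //=.
have vE2' : ivar s2 2 = k by [].
split; [by split | by rewrite /= vE2' addn1 | move=> u].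
rewrite ltnS leq_eqVlt /= /update /= vE2' E7 E8
  -!/(rank _ _) -/(num_before _ _ _).
have [uk _|uk /= ltu] := eqVneq (u : nat) k.
  have -> : u = v by apply: val_inj.
  by rewrite eqxx.
have [e2 e3 e1] := srt u ltu.
rewrite iE2 e2 e1; split=> //.
(* Distinct vertices have distinct ranks, so earlier entries of integer array 3 are not
   overwritten. *)
rewrite eqn_pmul2r // (inj_eq (@rank_inj _ _ _)).
by rewrite ifN // -(inj_eq val_inj).
Qed.

(** * The table of optimal weights *)

Definition sorted s : Prop :=
  ready s /\ forall v, iarr s 2 v = nb v * B.+1 /\ iarr s 3 (rk v * B.+1) = v.

(** The machine stores only the weight; an optimal set attaining it is a ghost witness. *)
Definition cell s k c : Prop :=
  exists S, opt k c S /\ rarr s 3 (k * B.+1 + c) = weight w S.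

Definition cleared s : Prop := forall v, iarr s 1 v = 0.

Lemma sort_inv_sorted s : sort_inv n s -> sorted s /\ cleared s.
Proof.
move=> [rd _ srt]; split; last by move=> v; have [] := srt v (ltn_ord v).
by split=> // v; have [] := srt v (ltn_ord v).
Qed.

Lemma cell_update s k c i a : k * B.+1 + c <> i ->
  cell s k c -> cell (set_rarr s 3 i a) k c.
Proof.
move=> /eqP/negPf ki [S [oS e]]; exists S; split=> //.
by rewrite /= /update /= ki.
Qed.

Definition row0_inv c s : Prop :=
  [/\ sorted s, cleared s, ivar s 3 = c & forall c', c' < c -> cell s 0 c'].

Lemma row0_correct s : row0_inv 0 s ->
  runs row0_loop s (B.+1 * 11 + 4) (row0_inv B.+1).
Proof.
move=> I0; apply: (runs_for (t := 7)) I0.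
  by move=> k s' [[[[_ BE _] _] _] _ kE _]; rewrite /= BE kE ltnS.
move=> c s' cB [srt cl cE tab].
apply: (runs_loop_free (p := Seq _ _)) => //=.
split; [exact: srt | exact: cl | by rewrite /= cE addn1 | move=> c'].
rewrite ltnS leq_eqVlt => /orP[/eqP->|ltc].
  exists set0; split; first exact: optimal_0.
  by rewrite /= /update /= cE eqxx weight_set0.
change (cell (set_rarr s' 3 (ivar s' 3) 0%R) 0 c').
by apply: cell_update; [rewrite cE; lia | apply: tab].
Qed.

Definition table_inv k s : Prop :=
  [/\ sorted s, cleared s, ivar s 2 = k, ivar s 5 = k * B.+1
    & forall k' c', k' <= k -> c' <= B -> cell s k' c'].

Definition row_inv v c s : Prop :=
  [/\ table_inv (rk v) s, ivar s 4 = v, ivar s 3 = c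
    & forall c', c' < c -> cell s (rk v).+1 c'].

Lemma row_step v c s : c <= B -> row_inv v c s ->
  row_inv v c.+1 (denote row_body s).
Proof.
move=> cB [[srt cl kE qE tab] vE cE row].
have [[[nE BE arr] WE] srtv] := srt.
have [_ _ wE bE] := arr v; have [nbE _] := srtv v.
pose i := (rk v).+1 * B.+1 + c.
(* Every branch writes a single real at index [i]; all that matters is that it is an optimal
   weight. *)
suff [a [sE [S [oS aE]]]] : exists a,
    denote row_body s = set_ivar (set_rarr s 3 i a) 3 c.+1 /\
    exists S, opt (rk v).+1 c S /\ a = weight w S.
  rewrite sE; split=> //.
  - split=> // k' c' k'le c'le.
    change (cell (set_rarr s 3 i a) k' c').
    apply: cell_update; last exact: tab.
    (* Rows have length [B.+1] and [c' <= B], so cells of rows up to [rk v] lie below index [i]. *)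
    have := leq_mul k'le (leqnn B.+1); rewrite /i mulSn; lia.
  - move=> c'; rewrite ltnS leq_eqVlt => /orP[/eqP->|ltc].
      by exists S; split=> //; rewrite /= /update /= eqxx.
    change (cell (set_rarr s 3 i a) (rk v).+1 c').
    by apply: cell_update; [rewrite /i; lia | apply: row].
have [S0 [o0 e0]] := tab (rk v) c (leqnn _) cB.
rewrite /= vE cE qE WE bE nbE wE e0 ?addn1.
have -> : rk v * B.+1 + B.+1 + c = i by rewrite /i mulSn; lia.
have [bc|nbc] /= := leqP (b v) c; last first.
  exists (weight w S0); rewrite ?cE ?addn1; split=> //.
  exists S0; split=> //; apply: (optimal_skip rep o0) => S1.
  by rewrite leqNgt nbc.
(* Row [nb v] is already filled because [nb v <= rk v]. *)
have [S1 [o1 e1]] := tab (nb v) (c - b v) (num_before_rank rep v)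
                         (leq_trans (leq_subr _ _) cB).
rewrite e1; case: ifPn => le01.
  exists (weight w S1 + w v)%R; rewrite /= ?cE ?addn1; split=> //.
  exists (v |: S1); split; first exact: (optimal_take rep bc o0 o1 le01).
  by rewrite weight_add // (notin_before rep o1.1).
exists (weight w S0); rewrite /= ?cE ?addn1; split=> //.
exists S0; split=> //; apply: (optimal_skip rep o0) => S _ fS.
rewrite -ltNge in le01; apply: le_trans (ltW le01).
by rewrite lerD2r; apply: o1.2.
Qed.

Lemma row_correct v s : row_inv v 0 s ->
  runs row_loop s (B.+1 * 60 + 4) (row_inv v B.+1).
Proof.
move=> I0; apply: (runs_for (t := 56)) I0.
  by move=> c s' [[[[[_ BE _] _] _] _ _ _ _] _ cE _]; rewrite /= BE cE ltnS.
move=> c s' cB inv.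
apply: (runs_weaken (runs_loop_free (Q := row_inv v c.+1) _ _)) => //.
exact: row_step.
Qed.

Lemma table_correct s : table_inv 0 s ->
  runs table_loop s (n * (B.+1 * 60 + 30) + 6) (table_inv n).
Proof.
move=> I0.
apply: (runs_weaken (t := n * (5 + (5 + (B.+1 * 60 + 4 + 8))).+1 + 6)
  _ _ (fun _ => id)); last by lia.
apply: (runs_for (t := 5 + (B.+1 * 60 + 4 + 8))) I0.
  by move=> k s' [[[[nE _ _] _] _] _ kE _ _]; rewrite /= nE kE addn1.
move=> k s' kn [srt cl kE qE tab].
have [v vk] := rank_surj r kn.
apply: (runs_Seq (Q1 := row_inv v 0)).
  apply: (runs_loop_free (p := table_pre)) => //=.
  split=> //; first by rewrite /rk vk.
  by rewrite /= /update /= qE -vk; have [] := srt.2 v.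
move=> s1 /row_correct h1; apply: runs_Seq h1 _.
move=> s2 [[srt2 cl2 kE2 qE2 tab2] _ _ row].
apply: (runs_loop_free (p := table_post)) => //=.
rewrite /rk vk in kE2 qE2 tab2 row; have [[_ WE] _] := srt2.
split=> //.
- by rewrite /= /update /= kE2 addn1.
- by rewrite /= /update /= qE2 WE mulSn addnC.
- move=> k' c'; rewrite leq_eqVlt => /orP[/eqP-> /row //|k'le c'le].
  exact: tab2.
Qed.

(** * Traceback and total running time *)

Definition table_filled s : Prop :=
  sorted s /\ forall k c, k <= n -> c <= B -> cell s k c.

(** Strong induction on the row, since taking a vertex may jump down many rows. Marks outside [S]
    keep their old value, which lets the sets found by successive steps be combined. *)
Lemma trace_correct i c s : table_filled s -> i <= n -> c <= B ->
  ivar s 5 = i * B.+1 -> ivar s 3 = c ->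
  runs trace_loop s (i * 60 + 4)
    (fun s' => exists S, opt i c S /\
       forall v, iarr s' 1 v = if v \in S then 1 else iarr s 1 v).
Proof.
elim/ltn_ind: i c s => -[|i] IH c s [srt tab] i_n cB qE cE.
  apply: runs_While_false; first by rewrite /= qE.
  exists set0; split; first exact: optimal_0.
  by move=> v; rewrite in_set0.
have [[[nE BE arr] WE] srtv] := srt.
have [v vi] := rank_surj r i_n.
have [nbE ordE] := srtv v; rewrite /rk vi in ordE; have [_ _ _ bE] := arr v.
have [S1 [o1 e1]] := tab i.+1 c i_n cB.
have [S0 [o0 e0]] := tab i c (ltnW i_n) cB.
have hq : i.+1 * B.+1 - B.+1 = i * B.+1 by rewrite mulSn addKn.
have hc : beval s (BILe (ILit 1) (IVar 5)) by rewrite /= qE mulSn.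
have body : denote trace_body s =
    if (weight w S1 <= weight w S0)%R
    then set_ivar (set_ivar s 4 v) 5 (i * B.+1)
    else set_ivar (set_ivar (set_iarr (set_ivar s 4 v) 1 v 1) 5 (nb v * B.+1))
                  3 (c - b v).
  rewrite /= /update /= qE WE cE hq e1 e0 ordE.
  by case: ifP => // _; rewrite /= /update /= nbE ?cE bE.
rewrite /opt -vi in o0 o1.
have [le10|nle10] := boolP (weight w S1 <= weight w S0)%R.
  rewrite le10 in body.
  apply: (runs_weaken (t := (3 + 50 + (i * 60 + 4)).+1) _ _ (fun _ => id)).
    apply: (runs_While_true (Q1 := fun s' => s' = denote trace_body s)) => //.
      exact: (runs_weaken (runs_loop_free (Q := fun s' => s' = _) _ erefl)).
    move=> _ ->; rewrite body.
    apply: runs_weaken (IH i _ c _ _ _ _ _ _) (leqnn _) _ => //.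
      exact: ltnW.
    move=> s' [S [oS hS]]; exists S; split=> //.
    rewrite /opt -vi; apply: optimal_trace_skip o0 o1 le10 _ => //.
    by rewrite vi.
  by lia.
have [bc take] := optimal_trace_take rep o0 o1 nle10.
rewrite (negPf nle10) in body.
(* The jump lands strictly below row [i.+1], so the induction hypothesis applies and its time bound
   fits. *)
have nbi : nb v <= i by rewrite -vi; exact: (num_before_rank rep v).
apply: (runs_weaken (t := (3 + 50 + (nb v * 60 + 4)).+1) _ _ (fun _ => id)).
  apply: (runs_While_true (Q1 := fun s' => s' = denote trace_body s)) => //.
    exact: (runs_weaken (runs_loop_free (Q := fun s' => s' = _) _ erefl)).
  move=> _ ->; rewrite body.
  apply: runs_weaken (IH (nb v) _ (c - b v) _ _ _ _ _ _) (leqnn _) _ => //.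
  - exact: leq_trans nbi (ltnW i_n).
  - exact: leq_trans (leq_subr _ _) cB.
  - move=> s' [S [oS hS]]; exists (v |: S); split.
      by rewrite /opt -vi; apply: take.
    move=> u; rewrite hS !inE /= /update /= (inj_eq val_inj).
    by case: (u == v); case: (u \in S).
by lia.
Qed.

Lemma mwbis_correct s : 0 < n -> 0 < B -> MWBIS_input l r w b B s ->
  runs mwbis s (1000 * (n * (n + B)))
    (fun s' => MWBIS_optimal E w b B (MWBIS_output n s')).
Proof.
move=> n0 B0 inp; have nE : ivar s 0 = n by case: inp.
pose sort_time := n * (n * 50 + 50) + 6.
pose table_time := n * (B.+1 * 60 + 30) + 6.
have [t [s' [h tle hs']]] : runs
    (Seq init (Seq sort_loop (Seq (ISet 3 (ILit 0)) (Seq row0_loop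
    (Seq init_table (Seq table_loop (Seq (ISet 3 (IVar 1)) trace_loop)))))))
    s (6 + (sort_time + (2 + (B.+1 * 11 + 4 + (4 + (table_time +
       (2 + (n * 60 + 4))))))))
    (fun s' => MWBIS_optimal E w b B (MWBIS_output n s')).
  apply: (runs_Seq (Q1 := sort_inv 0)).
    apply: (runs_loop_free (p := init)) => //.
    by split=> //; split=> //=; rewrite addn1; case: inp => _ ->.
  move=> s1 /sort_correct h1; apply: runs_Seq h1 _=> s2.
  move=> /sort_inv_sorted[srt cl].
  apply: (runs_Seq (Q1 := row0_inv 0)).
    exact: (runs_loop_free (p := ISet _ _)).
  move=> s3 /row0_correct h3; apply: runs_Seq h3 _ => s4 [srt4 cl4 _ row].
  apply: (runs_Seq (Q1 := table_inv 0)).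
    apply: (runs_loop_free (p := init_table)) => //.
    by split=> // k c; rewrite leqn0 => /eqP->; apply: row.
  move=> s5 /table_correct h5.
  apply: runs_Seq h5 _ => s6 [srt6 cl6 _ qE tab].
  apply: (runs_Seq (Q1 := fun s7 => s7 = set_ivar s6 3 B)).
    apply: (runs_loop_free (p := ISet _ _)) => //=.
    by have [[[_ -> _] _] _] := srt6.
  move=> _ ->.
  apply: (runs_weaken (trace_correct (i := n) (c := B) _ _ _ _ _)) => //.
  move=> s7 [S [oS hS]]; suff -> : MWBIS_output n s7 = S.
    exact: optimal_MWBIS oS.
  apply/setP => v; rewrite inE hS [iarr _ _ _]cl6.
  by case: (v \in S).
exists (3 + t).+1, s'; split=> //; last first.
  (* Since [n > 0], the cost O(B) of row 0 and the additive constants are absorbed by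
     [n * (n + B)]. *)
  move: tle; rewrite /sort_time /table_time; nia.
by apply: exec_If_true h; rewrite /= nE.
Qed.

End Program_correctness.

Theorem theorem5 (R : realType) :
  exists (p : com) (C : nat),
    forall (n B : nat) (E : rel 'I_n) (l r w : 'I_n -> R) (b : 'I_n -> nat),
      interval_representation E l r ->
      (forall v, 0 < w v)%R ->
      (forall v, 0 < b v) ->
      0 < B ->
      forall s : state R, MWBIS_input l r w b B s ->
        exists (t : nat) (s' : state R),
          [/\ exec p s t s',
              t <= C * maxn 1 (n * (n + B))
            & MWBIS_optimal E w b B (MWBIS_output n s')].
Proof.
exists mwbis, 1000 => n B E l r w b rep _ _ B0 s inp.
have [n0|n0] := posnP n; last first.
  have [t [s' [h tle opt]]] := mwbis_correct rep n0 B0 inp.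
  exists t, s'; split=> //; apply: leq_trans tle _.
  by rewrite leq_mul2l leq_maxr orbT.
have nE : ivar s 0 = 0 by case: inp => ->.
(* For [n = 0] the product vanishes but the test and [Skip] still cost 5; the [maxn 1] in the bound
   pays for them. *)
exists (3 + 1).+1, s; split.
- by apply: exec_If_false; [rewrite /= nE | apply: exec_Skip].
- by apply: (@leq_trans 1000) => //; rewrite leq_pmulr // leq_maxl.
- have S0 (S : {set 'I_n}) : S = set0.
    by apply/setP => v; move: (ltn_ord v); rewrite [X in _ < X]n0.
  rewrite [MWBIS_output _ _]S0; split=> [|S' _]; last by rewrite [S']S0.
  split; first by move=> u v; rewrite in_set0.
  by rewrite /budget big_set0.
Qed.
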